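(* Consider the planar system, depending on the parameter $\mu=(\mu_1,\mu_2)\in\mathbb{R}^2$ with $|\mu|$ sufficiently small, $$\frac{d\xi_1}{dt}=\xi_1\left(\mu_1-\theta(\mu)\xi_1+\gamma(\mu)\xi_2-M(\mu)\xi_1\xi_2+N(\mu)\xi_1^2\right),\qquad \frac{d\xi_2}{dt}=\xi_2\left(\mu_2-\delta(\mu)\xi_1+\xi_2+S(\mu)\xi_1^2+P(\mu)\xi_2^2\right),$$ where $\theta,\gamma,\delta,M,N,S,P$ are smooth functions of $\mu$ near $0$; write $\theta=\theta(0)$, $\gamma=\gamma(0)$, $\delta=\delta(0)$, and let $\gamma<0$ and $\theta\delta\ne 0$. Let $E_3=(\xi_1,\xi_2)$ be the equilibrium defined in the context, and consider those $\mu$ with $|\mu|$ sufficiently small for which $E_3$ lies in the first quadrant, i.e. $\xi_1>0$ and $\xi_2>0$. Let $2p$ be the trace of the Jacobian matrix of the system at $E_3$. 1) Assume $\theta-\gamma\delta<0$. Then $E_3$ is stable (node or focus) where $p<0$ and unstable where $p>0$. In particular, if $\delta>0$ then $E_3$ is an unstable node. 2) Assume $\theta-\gamma\delta>0$. Then $E_3$ is a saddle.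
   Context: Here $|\mu|=\sqrt{\mu_1^2+\mu_2^2}$. The system is studied only in the first quadrant and near the origin. When $\theta-\gamma\delta\ne 0$, $E_3=(\xi_1,\xi_2)$ is the unique solution near the origin (for $|\mu|$ small), given by the Implicit Function Theorem, of $$\mu_1-\theta\xi_1+\gamma\xi_2-M\xi_1\xi_2+N\xi_1^2=0,\qquad \mu_2-\delta\xi_1+\xi_2+S\xi_1^2+P\xi_2^2=0$$ (coefficients evaluated at $\mu$). Its coordinates are $$\xi_1=\tfrac{\mu_1}{\theta-\gamma\delta}(1+O(|\mu|))-\tfrac{\gamma\mu_2}{\theta-\gamma\delta}(1+O(|\mu|)),\qquad \xi_2=\tfrac{\delta\mu_1}{\theta-\gamma\delta}(1+O(|\mu|))-\tfrac{\theta\mu_2}{\theta-\gamma\delta}(1+O(|\mu|)).$$ The characteristic polynomial of the Jacobian at $E_3$ is written $\lambda^2-2p\lambda+L$, where $$p=\tfrac12\xi_2-\tfrac12\theta\xi_1+N\xi_1^2-\tfrac12 M\xi_1\xi_2+P\xi_2^2,$$ and the eigenvalues are $\lambda_{1,2}=p\pm\sqrt{q}$ with $q=p^2-L$. An equilibrium is a node if both eigenvalues are real, non-zero and of the same sign; a focus if they are non-real with non-zero real part; a saddle if they are real of opposite signs. A node or focus is stable (unstable) if the eigenvalues have negative (positive) real part. *)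

(* Defs.v *)
From HB Require Import structures.
From mathcomp Require Import all_boot all_order all_algebra.
From mathcomp Require Import all_classical all_reals all_analysis.
From mathcomp Require Import complex.

Set Implicit Arguments.
Unset Strict Implicit.
Unset Printing Implicit Defensive.

Import Order.TTheory GRing.Theory Num.Theory numFieldNormedType.Exports.
Local Open Scope classical_set_scope.
Local Open Scope ring_scope.
Local Open Scope complex_scope.

(* The library norm on row vectors is the sup norm. *)
Definition enorm (R : realType) (x : 'rV[R]_2) : R :=
  Num.sqrt (x 0 0 ^+ 2 + x 0 1 ^+ 2).

(* C^k on an open set U, by iterated continuous partial derivatives.  The
   values of 'D_v f outside U are irrelevant because U is open. *)
Fixpoint Ck_on (R : realType) (n k : nat) (U : set 'rV[R]_n)
    (f : 'rV[R]_n -> R) : Prop :=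
  (forall x, U x -> {for x, continuous f}) /\
  if k is k'.+1 then
    forall i : 'I_n,
      (forall x, U x -> derivable f x (delta_mx 0 i)) /\
      Ck_on k' U (fun x => 'D_(delta_mx 0 i) f x)
  else True.

Definition smooth_near0 (R : realType) (n : nat) (f : 'rV[R]_n -> R) : Prop :=
  exists U : set 'rV[R]_n, [/\ open U, U 0 & forall k, Ck_on k U f].

Record coeffs (R : realType) := Coeffs {
  theta : 'rV[R]_2 -> R;
  gamma : 'rV[R]_2 -> R;
  delta : 'rV[R]_2 -> R;
  cM : 'rV[R]_2 -> R;
  cN : 'rV[R]_2 -> R;
  cS : 'rV[R]_2 -> R;
  cP : 'rV[R]_2 -> R
}.

Definition smooth_coeffs (R : realType) (c : coeffs R) : Prop :=
  [/\ smooth_near0 (theta c), smooth_near0 (gamma c) & smooth_near0 (delta c)]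
  /\ [/\ smooth_near0 (cM c), smooth_near0 (cN c), smooth_near0 (cS c)
       & smooth_near0 (cP c)].

Definition growth1 (R : realType) (c : coeffs R) (mu xi : 'rV[R]_2) : R :=
  mu 0 0 - theta c mu * xi 0 0 + gamma c mu * xi 0 1
  - cM c mu * xi 0 0 * xi 0 1 + cN c mu * xi 0 0 ^+ 2.

Definition growth2 (R : realType) (c : coeffs R) (mu xi : 'rV[R]_2) : R :=
  mu 0 1 - delta c mu * xi 0 0 + xi 0 1
  + cS c mu * xi 0 0 ^+ 2 + cP c mu * xi 0 1 ^+ 2.

Definition vfield (R : realType) (c : coeffs R) (mu xi : 'rV[R]_2) :
    'rV[R]_2 :=
  \row_(i < 2) if i == 0 then xi 0 0 * growth1 c mu xi
               else xi 0 1 * growth2 c mu xi.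

(* E is the branch given by the implicit function theorem at the origin: it is
   continuous with E 0 = 0 and, for mu near 0, E mu is the only common zero of
   growth1 and growth2 in a fixed ball around the origin. *)
Definition E3_branch (R : realType) (c : coeffs R)
    (E : 'rV[R]_2 -> 'rV[R]_2) : Prop :=
  [/\ E 0 = 0,
      {for 0, continuous E} &
      exists r eps : R, [/\ 0 < r, 0 < eps &
        forall mu, enorm mu < eps ->
          [/\ enorm (E mu) < r,
              growth1 c mu (E mu) = 0 /\ growth2 c mu (E mu) = 0 &
              forall xi, enorm xi < r ->
                growth1 c mu xi = 0 -> growth2 c mu xi = 0 -> xi = E mu]]].

(* The library's Jacobian acts on row vectors, so it is the transpose of the
   usual one; trace and eigenvalues are unaffected. *)
Definition jac (R : realType) (c : coeffs R) (mu xi : 'rV[R]_2) : 'M[R]_2 :=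
  'J (vfield c mu) xi.

Definition half_trace (R : realType) (A : 'M[R]_2) : R := \tr A / 2.

Definition cplx_eigenvalue (R : realType) (A : 'M[R]_2) (z : R[i]) : Prop :=
  eigenvalue (map_mx (real_complex R) A) z.

Definition is_node (R : realType) (A : 'M[R]_2) : Prop :=
  (forall z, cplx_eigenvalue A z -> complex.Im z = 0 /\ complex.Re z != 0) /\
  (forall z w, cplx_eigenvalue A z -> cplx_eigenvalue A w ->
     Num.sg (complex.Re z) = Num.sg (complex.Re w)).

Definition is_focus (R : realType) (A : 'M[R]_2) : Prop :=
  forall z, cplx_eigenvalue A z -> complex.Im z != 0 /\ complex.Re z != 0.

Definition is_saddle (R : realType) (A : 'M[R]_2) : Prop :=
  (forall z, cplx_eigenvalue A z -> complex.Im z = 0) /\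
  (exists z w, [/\ cplx_eigenvalue A z, cplx_eigenvalue A w,
     complex.Re z < 0 & 0 < complex.Re w]).

Definition spec_stable (R : realType) (A : 'M[R]_2) : Prop :=
  forall z, cplx_eigenvalue A z -> complex.Re z < 0.

Definition spec_unstable (R : realType) (A : 'M[R]_2) : Prop :=
  forall z, cplx_eigenvalue A z -> 0 < complex.Re z.

(* Main.v *)
(* On the branch E_3 both growth rates vanish, so the Jacobian is the Jacobian
   of the growth rates with its rows scaled by xi_1 > 0 and xi_2 > 0.  By
   continuity its determinant is xi_1 xi_2 (- (theta - gamma delta) + o(1)),
   and the signs of trace and determinant decide the type.  When delta > 0 and
   theta < gamma delta < 0, the trace is positive and the off-diagonal product
   (near - gamma delta > 0) makes the discriminant
   (A11 - A22)^2 + 4 A12 A21 nonnegative, so both eigenvalues are real. *)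
From HB Require Import structures.
Require Import Defs.
From mathcomp Require Import all_boot all_order all_algebra.
From mathcomp Require Import all_classical all_reals all_analysis.
From mathcomp Require Import complex ring lra.
Import Order.TTheory GRing.Theory Num.Theory numFieldNormedType.Exports.
Local Open Scope ring_scope.
Local Open Scope classical_set_scope.
Set Implicit Arguments.
Unset Strict Implicit.
Unset Printing Implicit Defensive.

(** * Two-by-two matrices, and Euclidean neighbourhoods of the origin *)

Lemma det_mx22 (R : comPzRingType) (A : 'M[R]_2) :
  \det A = A 0 0 * A 1 1 - A 0 1 * A 1 0.
Proof.
rewrite (expand_det_row _ ord0) big_ord_recl big_ord1 /cofactor !det_mx11 !mxE /=.
have -> : lift ord0 ord0 = 1 :> 'I_2 by apply: val_inj.
have -> : lift (1 : 'I_2) (0 : 'I_1) = 0 by apply: val_inj.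
have -> : ord0 = 0 :> 'I_2 by apply: val_inj.
by rewrite addn0 expr0 mul1r expr1 mulN1r mulrN.
Qed.

Lemma mxtrace2 (R : pzSemiRingType) (A : 'M[R]_2) : \tr A = A 0 0 + A 1 1.
Proof.
rewrite /mxtrace big_ord_recl big_ord1.
have -> : lift ord0 ord0 = 1 :> 'I_2 by apply: val_inj.
by have -> : ord0 = 0 :> 'I_2 by apply: val_inj.
Qed.

Lemma root_char_poly2 (F : fieldType) (A : 'M[F]_2) (z : F) :
  root (char_poly A) z = (z ^+ 2 - \tr A * z + \det A == 0).
Proof.
rewrite /root /char_poly det_mx22 /char_poly_mx !mxE.
(* The index tests are decided by conversion, so that each entry of the characteristic matrix
   reduces. *)
rewrite -[0 == 0 :> 'I_2]/true -[1 == 1 :> 'I_2]/true.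
rewrite -[0 == 1 :> 'I_2]/false -[1 == 0 :> 'I_2]/false.
rewrite !mulr1n !mulr0n !hornerE.
by rewrite mxtrace2 det_mx22; congr (_ == 0); ring.
Qed.

(** Real and imaginary parts of [z ^+ 2 - \tr A * z + \det A = 0]. The second equation gives the
    dichotomy used below: either [z] is real or its real part is half the trace. *)
Lemma cplx_eigenvalueP (R : realType) (A : 'M[R]_2) (z : R[i]%C) :
  cplx_eigenvalue A z <->
  complex.Re z ^+ 2 - complex.Im z ^+ 2 - \tr A * complex.Re z + \det A = 0 /\
  complex.Im z * (2 * complex.Re z - \tr A) = 0.
Proof.
rewrite /cplx_eigenvalue eigenvalue_root_char root_char_poly2.
rewrite det_map_mx trace_map_mx.
case: z => u v; rewrite eq_complex /=; split.
  by case/andP => /eqP h1 /eqP h2; split; lra.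
by case=> h1 h2; apply/andP; split; apply/eqP; lra.
Qed.

(** The sup norm is at most the Euclidean norm, so a Euclidean ball sits inside the sup-norm ball of
    the same radius. *)
Lemma near0_enorm (R : realType) (P : set 'rV[R]_2) :
  (\forall mu \near (0 : 'rV[R]_2), P mu) ->
  exists2 eps : R, 0 < eps & forall mu, enorm mu < eps -> P mu.
Proof.
move=> /nbhs_ballP[e /= e0 eP]; exists e => // mu hmu; apply: eP; split => // i j.
rewrite /ball /= mxE sub0r normrN (ord1 i); apply: le_lt_trans hmu.
rewrite /enorm -sqrtr_sqr ler_wsqrtr //.
case: j => -[|[|//]] hj.
  have -> : Ordinal hj = 0 by apply: val_inj.
  by rewrite lerDl sqr_ge0.
have -> : Ordinal hj = 1 by apply: val_inj.
by rewrite lerDr sqr_ge0.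
Qed.

(** * Differential of the vector field and its Jacobian on the branch *)

Lemma is_diff_coord (R : realType) (n : nat) (j : 'I_n) (x : 'rV[R]_n) :
  is_diff x (fun v : 'rV[R]_n => v 0 j : R) (fun v : 'rV[R]_n => v 0 j : R).
Proof.
have lin : linear (fun v : 'rV[R]_n => v 0 j : R) by move=> a u v; rewrite !mxE.
pose fl := GRing.isLinear.Build _ _ _ _ _ lin.
pose f : {linear 'rV[R]_n -> R} := HB.pack (fun v : 'rV[R]_n => v 0 j : R) fl.
apply: DiffDef; first exact: differentiable_coord.
exact: (@diff_lin _ _ _ f x (@coord_continuous _ _ _ _ _)).
Qed.

Lemma is_diff_row2 (R : realType) n (f g df dg : 'rV[R]_n -> R) (x : 'rV[R]_n) :
  is_diff x f df -> is_diff x g dg ->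
  is_diff x (fun v => \row_(i < 2) if i == 0 then f v else g v)
            (fun v => \row_(i < 2) if i == 0 then df v else dg v).
Proof.
move=> hf hg.
(* Written as a sum of scalar functions times constant basis vectors, the row is covered by the sum
   and scaling rules for differentials. *)
have rowE (a b : R) : \row_(i < 2) (if i == 0 then a else b)
    = a *: delta_mx 0 0 + b *: delta_mx 0 1.
  apply/rowP => j; rewrite !mxE !eqxx /=.
  by case: j => -[|[|//]] hj /=; rewrite ?(mulr1, mulr0, addr0, add0r).
under eq_fun do rewrite rowE.
under [X in is_diff _ _ X]eq_fun do rewrite rowE.
have h1 := is_diff_comp hf (is_diff_scalel (f x) (delta_mx 0 0 : 'rV[R]_2)).
have h2 := is_diff_comp hg (is_diff_scalel (g x) (delta_mx 0 1 : 'rV[R]_2)).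
exact: is_diffD h1 h2.
Qed.

Lemma jacobianE (R : realType) m n (f df : 'rV[R]_m -> 'rV[R]_n) x i j :
  is_diff x f df -> 'J f x i j = df (delta_mx 0 i) 0 j.
Proof. by move=> h; rewrite /jacobian /lin1_mx mxE diff_val. Qed.

Section GrowthPartials.
Variables (R : realType) (c : coeffs R) (mu xi : 'rV[R]_2).

(** In these four names the first digit is the variable of differentiation and the last one the
    growth rate. *)
Definition d1growth1 := - theta c mu - cM c mu * xi 0 1 + 2 * cN c mu * xi 0 0.
Definition d2growth1 := gamma c mu - cM c mu * xi 0 0.
Definition d1growth2 := - delta c mu + 2 * cS c mu * xi 0 0.
Definition d2growth2 := 1 + 2 * cP c mu * xi 0 1.

End GrowthPartials.

(** The product rule is left unexpanded, so that the terms carrying an undifferentiated growth rate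
    visibly vanish on the branch. *)
Definition vfield_diff (R : realType) (c : coeffs R) (mu xi v : 'rV[R]_2) : 'rV[R]_2 :=
  \row_(i < 2) if i == 0 then
    growth1 c mu xi * v 0 0 + xi 0 0 *
      (d1growth1 c mu xi * v 0 0 + d2growth1 c mu xi * v 0 1)
  else
    growth2 c mu xi * v 0 1 + xi 0 1 *
      (d1growth2 c mu xi * v 0 0 + d2growth2 c mu xi * v 0 1).

Lemma is_diff_vfield (R : realType) (c : coeffs R) (mu xi : 'rV[R]_2) :
  is_diff xi (vfield c mu) (vfield_diff c mu xi).
Proof.
have hx := is_diff_coord 0 xi; have hy := is_diff_coord 1 xi.
set X := (fun v : 'rV[R]_2 => v 0 0 : R) in hx.
set Y := (fun v : 'rV[R]_2 => v 0 1 : R) in hy.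
apply: is_diff_row2.
- have -> : (fun v : 'rV[R]_2 => v 0 0 * growth1 c mu v) =
    X * (cst (mu 0 0) - theta c mu *: X + gamma c mu *: Y
         - cM c mu *: (X * Y) + cN c mu *: X ^+ 2).
    apply/funext => v; rewrite /growth1 /X /Y.
    by rewrite !fctE /GRing.scale /= !mulrA.
  (* The index of [is_diffX] is one less than the exponent: [1] differentiates the square. *)
  have h := is_diffM hx (is_diffD (is_diffB (is_diffD (is_diffB
    (is_diff_cst (mu 0 0) xi) (is_diffZ (theta c mu) hx))
    (is_diffZ (gamma c mu) hy)) (is_diffZ (cM c mu) (is_diffM hx hy)))
    (is_diffZ (cN c mu) (is_diffX 1 hx))).
  apply: (is_diff_eq h); apply/funext => v.
  rewrite /growth1 /d1growth1 /d2growth1 /X /Y !fctE /GRing.scale /= -[0 v]/(0 : R).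
  ring.
- have -> : (fun v : 'rV[R]_2 => v 0 1 * growth2 c mu v) =
    Y * (cst (mu 0 1) - delta c mu *: X + Y + cS c mu *: X ^+ 2
         + cP c mu *: Y ^+ 2).
    apply/funext => v; rewrite /growth2 /X /Y.
    by rewrite !fctE /GRing.scale /=.
  have h := is_diffM hy (is_diffD (is_diffD (is_diffD (is_diffB
    (is_diff_cst (mu 0 1) xi) (is_diffZ (delta c mu) hx)) hy)
    (is_diffZ (cS c mu) (is_diffX 1 hx))) (is_diffZ (cP c mu) (is_diffX 1 hy))).
  apply: (is_diff_eq h); apply/funext => v.
  rewrite /growth2 /d1growth2 /d2growth2 /X /Y !fctE /GRing.scale /= -[0 v]/(0 : R).
  ring.
Qed.

(** With both growth rates zero, only the gradient of each growth rate survives, scaled by its own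
    coordinate; the two scalars factor out of the determinant. *)
Lemma tr_det_jac (R : realType) (c : coeffs R) (mu xi : 'rV[R]_2) :
  growth1 c mu xi = 0 -> growth2 c mu xi = 0 ->
  \tr (jac c mu xi) = xi 0 0 * d1growth1 c mu xi + xi 0 1 * d2growth2 c mu xi /\
  \det (jac c mu xi) = xi 0 0 * xi 0 1 *
    (d1growth1 c mu xi * d2growth2 c mu xi - d2growth1 c mu xi * d1growth2 c mu xi).
Proof.
move=> g1 g2.
have jE i j := jacobianE i j (is_diff_vfield c mu xi).
rewrite mxtrace2 det_mx22 /jac !jE /vfield_diff g1 g2 !mxE.
rewrite -[0 == 0 :> 'I_2]/true -[1 == 1 :> 'I_2]/true.
rewrite -[0 == 1 :> 'I_2]/false -[1 == 0 :> 'I_2]/false /=.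
by split; ring.
Qed.

(** * Type of an equilibrium from trace, determinant and discriminant *)

Section FromTraceDet.
Variables (R : realType) (A : 'M[R]_2).

(** A non-real eigenvalue has real part [\tr A / 2]. A real [u >= 0] cannot be a root, since every
    term of [u ^+ 2 - \tr A * u + \det A] is nonnegative and the last is positive. *)
Lemma spec_stable_tr_det : \tr A < 0 -> 0 < \det A -> spec_stable A.
Proof.
move=> t0 d0 [u v] /cplx_eigenvalueP /= [h1 /eqP].
rewrite mulf_eq0 => /orP[/eqP v0|/eqP h2]; last lra.
rewrite ltNge; apply/negP => u0; move: h1; rewrite v0; nra.
Qed.

Lemma spec_unstable_tr_det : 0 < \tr A -> 0 < \det A -> spec_unstable A.
Proof.
move=> t0 d0 [u v] /cplx_eigenvalueP /= [h1 /eqP].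
rewrite mulf_eq0 => /orP[/eqP v0|/eqP h2]; last lra.
rewrite ltNge; apply/negP => u0; move: h1; rewrite v0; nra.
Qed.

(** If [u] is half the trace, the real-part equation says that the discriminant is [- 4 * v ^+ 2],
    which forces [v = 0]. *)
Lemma real_spectrum z : 0 <= \tr A ^+ 2 - 4 * \det A ->
  cplx_eigenvalue A z -> complex.Im z = 0.
Proof.
case: z => u v disc /cplx_eigenvalueP /= [h1 /eqP].
rewrite mulf_eq0 => /orP[/eqP //|/eqP h2]; apply/eqP.
rewrite -sqrf_eq0 eq_le sqr_ge0 andbT.
have ht : \tr A = 2 * u by lra.
by move: disc h1; rewrite ht; nra.
Qed.

Lemma is_node_tr_det : spec_stable A \/ spec_unstable A ->
  0 <= \tr A ^+ 2 - 4 * \det A -> is_node A.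
Proof.
move=> hs disc; split => [z hz|z w hz hw].
  split; first exact: real_spectrum hz.
  case: hs => /(_ z hz) hz0; by [rewrite lt_eqF|rewrite gt_eqF].
case: hs => h; first by rewrite !ltr0_sg ?h.
by rewrite !gtr0_sg ?h.
Qed.

(** A real eigenvalue [u] would make the discriminant equal to the square of [2 * u - \tr A]. *)
Lemma is_focus_tr_det : spec_stable A \/ spec_unstable A ->
  \tr A ^+ 2 - 4 * \det A < 0 -> is_focus A.
Proof.
move=> hs disc z hz; split; last first.
  case: hs => /(_ z hz) hz0; by [rewrite lt_eqF|rewrite gt_eqF].
case: z hz => u v /cplx_eigenvalueP /= [h1 _]; apply/eqP => v0.
by move: h1; rewrite v0 => h1; have := sqr_ge0 (2 * u - \tr A); nra.
Qed.

Lemma is_node_or_focus : spec_stable A \/ spec_unstable A ->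
  is_node A \/ is_focus A.
Proof.
move=> hs; case: (lerP 0 (\tr A ^+ 2 - 4 * \det A)) => disc.
  by left; exact: is_node_tr_det.
by right; exact: is_focus_tr_det.
Qed.

(** A negative determinant makes the root [s] of the discriminant exceed the absolute value of the
    trace, so the eigenvalues [(\tr A - s) / 2] and [(\tr A + s) / 2] lie on either side of zero. *)
Lemma is_saddle_det : \det A < 0 -> is_saddle A.
Proof.
move=> d0; have disc : 0 <= \tr A ^+ 2 - 4 * \det A.
  by have := sqr_ge0 (\tr A); lra.
split=> [z|]; first exact: real_spectrum.
set s := Num.sqrt (\tr A ^+ 2 - 4 * \det A).
have s2 : s ^+ 2 = \tr A ^+ 2 - 4 * \det A by rewrite sqr_sqrtr.
have s0 : 0 <= s by exact: sqrtr_ge0.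
have : `|\tr A| < s by rewrite -ltr_sqr ?nnegrE // real_normK ?num_real // s2; lra.
rewrite ltr_norml => /andP[h1 h2].
exists ((\tr A - s) / 2)%:C%C, ((\tr A + s) / 2)%:C%C; split => /=; try lra.
- by apply/cplx_eigenvalueP => /=; split; first nra; lra.
- by apply/cplx_eigenvalueP => /=; split; first nra; lra.
Qed.
End FromTraceDet.

(** * Limits along the branch as [mu] tends to the origin *)

Lemma cvg_smooth (R : realType) n (f : 'rV[R]_n -> R) :
  smooth_near0 f -> f mu @[mu --> (0 : 'rV[R]_n)] --> f 0.
Proof. by case=> U [_ U0 /(_ 0%N) [fU _]]; exact: fU. Qed.

Section BranchLimits.
Variables (R : realType) (c : coeffs R) (E : 'rV[R]_2 -> 'rV[R]_2).
Hypotheses (hsmooth : smooth_coeffs c) (hE : E3_branch c E).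

Let cvgE i : E mu 0 i @[mu --> (0 : 'rV[R]_2)] --> (0 : R).
Proof.
case: hE => E0 cE _.
have -> : (0 : R) = E 0 0 i by rewrite E0 mxE.
exact: (continuous_comp cE (@coord_continuous _ _ _ _ _ _)).
Qed.

Lemma cvg_d1growth1 : d1growth1 c mu (E mu) @[mu --> (0 : 'rV[R]_2)] --> - theta c 0.
Proof.
case: hsmooth => -[th _ _] [m n _ _].
(* The limit is given the shape of the partial derivative, with the branch replaced by its limit 0,
   so that the limit rules apply term by term. *)
have -> : - theta c 0 = - theta c 0 - cM c 0 * 0 + 2 * cN c 0 * 0 by ring.
exact: (cvgD (cvgB (cvgN (cvg_smooth th)) (cvgM (cvg_smooth m) (cvgE 1)))
  (cvgM (cvgM (cvg_cst (2 : R)) (cvg_smooth n)) (cvgE 0))).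
Qed.

Lemma cvg_d2growth1 : d2growth1 c mu (E mu) @[mu --> (0 : 'rV[R]_2)] --> gamma c 0.
Proof.
case: hsmooth => -[_ ga _] [m _ _ _].
have -> : gamma c 0 = gamma c 0 - cM c 0 * 0 by ring.
exact: (cvgB (cvg_smooth ga) (cvgM (cvg_smooth m) (cvgE 0))).
Qed.

Lemma cvg_d1growth2 : d1growth2 c mu (E mu) @[mu --> (0 : 'rV[R]_2)] --> - delta c 0.
Proof.
case: hsmooth => -[_ _ de] [_ _ s _].
have -> : - delta c 0 = - delta c 0 + 2 * cS c 0 * 0 by ring.
exact: (cvgD (cvgN (cvg_smooth de))
  (cvgM (cvgM (cvg_cst (2 : R)) (cvg_smooth s)) (cvgE 0))).
Qed.

Lemma cvg_d2growth2 : d2growth2 c mu (E mu) @[mu --> (0 : 'rV[R]_2)] --> (1 : R).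
Proof.
case: hsmooth => _ [_ _ _ p].
rewrite -[X in _ --> X](_ : 1 + 2 * cP c 0 * 0 = _); last by ring.
exact: (cvgD (cvg_cst (1 : R)) (cvgM (cvgM (cvg_cst (2 : R)) (cvg_smooth p)) (cvgE 1))).
Qed.

Lemma cvg_detgrowth :
  d1growth1 c mu (E mu) * d2growth2 c mu (E mu) -
  d2growth1 c mu (E mu) * d1growth2 c mu (E mu) @[mu --> (0 : 'rV[R]_2)] -->
  - (theta c 0 - gamma c 0 * delta c 0).
Proof.
rewrite (_ : - (_ - _) = - theta c 0 * 1 - gamma c 0 * - delta c 0); last by ring.
exact: (cvgB (cvgM cvg_d1growth1 cvg_d2growth2)
  (cvgM cvg_d2growth1 cvg_d1growth2)).
Qed.

Lemma near_branch_zero :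
  \forall mu \near (0 : 'rV[R]_2), growth1 c mu (E mu) = 0 /\ growth2 c mu (E mu) = 0.
Proof.
case: hE => _ _ [r [eps [_ e0 he]]].
(* Two coordinates below [eps / 2] in absolute value have squares summing to less than
   [eps ^+ 2 / 2], hence Euclidean norm below [eps]. *)
apply/nbhs_ballP; exists (eps / 2) => /=; first exact: divr_gt0.
move=> mu [_ hmu]; suff /he[] : enorm mu < eps by [].
have h0 := hmu 0 0; have h1 := hmu 0 1; move: h0 h1.
rewrite /ball /= !mxE !sub0r !normrN => h0 h1.
rewrite /enorm -(gtr0_norm e0) -sqrtr_sqr ltr_sqrt ?exprn_gt0 //.
rewrite -[mu 0 0 ^+ 2]real_normK ?num_real // -[mu 0 1 ^+ 2]real_normK ?num_real //.
have := normr_ge0 (mu 0 0); have := normr_ge0 (mu 0 1); nra.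
Qed.

End BranchLimits.

(** * Sign of the discriminant, and the classification of the equilibrium *)

Lemma scaled_disc_ge0 (R : realDomainType) (x y a b d e : R) :
  0 <= x -> 0 <= y -> 0 <= b * d ->
  0 <= (x * a + y * e) ^+ 2 - 4 * (x * y * (a * e - b * d)).
Proof.
move=> x0 y0 bd0.
have -> : (x * a + y * e) ^+ 2 - 4 * (x * y * (a * e - b * d)) =
    (x * a - y * e) ^+ 2 + 4 * (x * y) * (b * d) by ring.
by rewrite addr_ge0 ?sqr_ge0 // mulr_ge0 // mulr_ge0 // mulr_ge0.
Qed.

Theorem theorem2p12 (R : realType) (c : coeffs R) (E : 'rV[R]_2 -> 'rV[R]_2)
    (hsmooth : smooth_coeffs c)
    (hgamma : gamma c 0 < 0)
    (hthetadelta : theta c 0 * delta c 0 != 0)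
    (hE : E3_branch c E) :
  (theta c 0 - gamma c 0 * delta c 0 < 0 ->
   exists2 eps : R, 0 < eps &
     forall mu : 'rV[R]_2, enorm mu < eps ->
       0 < E mu 0 0 -> 0 < E mu 0 1 ->
       let J := jac c mu (E mu) in
       [/\ half_trace J < 0 -> (is_node J \/ is_focus J) /\ spec_stable J,
           0 < half_trace J -> (is_node J \/ is_focus J) /\ spec_unstable J
         & 0 < delta c 0 -> is_node J /\ spec_unstable J]) /\
  (0 < theta c 0 - gamma c 0 * delta c 0 ->
   exists2 eps : R, 0 < eps &
     forall mu : 'rV[R]_2, enorm mu < eps ->
       0 < E mu 0 0 -> 0 < E mu 0 1 ->
       is_saddle (jac c mu (E mu))).
Proof.
have c11 := cvg_d1growth1 hsmooth hE; have c12 := cvg_d2growth1 hsmooth hE.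
have c21 := cvg_d1growth2 hsmooth hE; have c22 := cvg_d2growth2 hsmooth hE.
have cdet := cvg_detgrowth hsmooth hE; have zero := near_branch_zero hE.
(* The saddle case comes first: there the sign of the determinant alone decides. *)
split=> hdet; last first.
  apply: near0_enorm.
  have hneg : \forall mu \near (0 : 'rV[R]_2),
      d1growth1 c mu (E mu) * d2growth2 c mu (E mu) -
      d2growth1 c mu (E mu) * d1growth2 c mu (E mu) < 0.
    by apply: (cvgr_lt _ cdet); rewrite oppr_lt0.
  apply: filterS2 zero hneg => mu [g1 g2] hneg x0 y0.
  have [_ det_J] := tr_det_jac g1 g2.
  by apply: is_saddle_det; rewrite det_J pmulr_rlt0 // mulr_gt0.
have hpos : \forall mu \near (0 : 'rV[R]_2),
    0 < d1growth1 c mu (E mu) * d2growth2 c mu (E mu) -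
      d2growth1 c mu (E mu) * d1growth2 c mu (E mu).
  by apply: (cvgr_gt _ cdet); rewrite oppr_gt0.
have hnode : \forall mu \near (0 : 'rV[R]_2), 0 < delta c 0 ->
    [/\ 0 < d1growth1 c mu (E mu), d2growth1 c mu (E mu) < 0,
        d1growth2 c mu (E mu) < 0 & 0 < d2growth2 c mu (E mu)].
  (* The sign of [delta c 0] does not depend on [mu], so the cases are split before [mu] is chosen;
     if it is not positive, the implication is vacuous. *)
  have [d0|d0] := ltrP 0 (delta c 0); last by near=> mu.
  (* Indeed [theta c 0] lies below [gamma c 0 * delta c 0], a product of a negative and a positive
     number. *)
  have th0 : 0 < - theta c 0 by nra.
  near=> mu => _; split; near: mu.
  - exact: (cvgr_gt _ c11).
  - exact: (cvgr_lt _ c12).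
  - by apply: (cvgr_lt _ c21); rewrite oppr_lt0.
  - by apply: (cvgr_gt _ c22); rewrite ltr01.
apply: near0_enorm; apply: filterS3 zero hpos hnode => mu [g1 g2] hpos hnode x0 y0.
have [tr_J det_J] := tr_det_jac g1 g2.
have d0 : 0 < \det (jac c mu (E mu)) by rewrite det_J pmulr_rgt0 // mulr_gt0.
rewrite /half_trace /=; split => [t0|t0|del0].
- have st : spec_stable (jac c mu (E mu)) by apply: spec_stable_tr_det => //; lra.
  by split => //; apply: is_node_or_focus; left.
- have st : spec_unstable (jac c mu (E mu)) by apply: spec_unstable_tr_det => //; lra.
  by split => //; apply: is_node_or_focus; right.
have [a11 a12 a21 a22] := hnode del0.
have st : spec_unstable (jac c mu (E mu)).
  by apply: spec_unstable_tr_det => //; rewrite tr_J addr_gt0 // mulr_gt0.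
split; last exact: st.
apply: is_node_tr_det; first by right.
rewrite tr_J det_J; apply: scaled_disc_ge0; [exact: ltW|exact: ltW|].
(* The two cross partials are both negative near the origin, so their product is positive. *)
by rewrite ltW // nmulr_rgt0.
Unshelve. all: by end_near. Qed.
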